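(* Let $f$ be an $S$-perfect structure over the $q$-ary $n$-cube $H_q^n$, and let $h_0$ be the value of $f$ at some fixed vertex. Then the weight enumerator $W_f(z)$ of $f$ with respect to this vertex satisfies $$W_f(z)=h_0\,Z_{S;n,q}(z),\qquad\text{where}\qquad Z_{S;n,q}(z)=(1-z)^{((q-1)nI-S)/q}\,(1+(q-1)z)^{(nI+S)/q}.$$
   Context: The $q$-ary $n$-cube $H_q^n$ ($q\ge2$) is the graph whose vertices are all words of length $n$ over $\{0,\dots,q-1\}$, two words being adjacent iff they differ in exactly one position. With $A$ its adjacency matrix and $S$ a real $\nu\times\nu$ matrix, an $S$-perfect structure over $H_q^n$ is a real $q^n\times\nu$ matrix $f$ with $Af=fS$, regarded also as a function on vertices with values the rows of $f$. The weight distribution of $f$ with respect to a vertex $x$ is $(h_0,\dots,h_n)^T$, where $h_w$ is the sum of $f(v)$ over all vertices $v$ at distance $w$ from $x$. The weight enumerator of $f$ with respect to $x$ is the vector-valued polynomial $W_f(z)=h_0+zh_1+\dots+z^nh_n$ in a real variable $z$. $I$ is the identity matrix. For a real number $t>0$ and a square matrix $M$, $t^M=\exp(M\ln t)$; the formula is understood for real $z$ with $1-z>0$ and $1+(q-1)z>0$. *)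

(* Defs.v *)
From HB Require Import structures.
From mathcomp Require Import all_boot all_order all_algebra.
From mathcomp Require Import all_classical all_reals all_analysis.
Import Order.TTheory GRing.Theory Num.Theory.
Import numFieldNormedType.Exports.

Set Implicit Arguments.
Unset Strict Implicit.
Unset Printing Implicit Defensive.

Local Open Scope classical_set_scope.
Local Open Scope ring_scope.

Section Graph.
Context {T : finType}.
Implicit Types (e : rel T) (x y : T).

Definition walk e (k : nat) x y : bool :=
  [exists p : k.-tuple T, path e x p && (last x p == y)].

(* The graph distance between x and y is exactly k; this never holds when
   x and y are not connected. *)
Definition at_distance e (k : nat) x y : bool :=
  walk e k x y && [forall j : 'I_k, ~~ walk e j x y].

(* Vertices index rows and columns through enum_rank / enum_val. *)
Definition adjacency_matrix (R : realType) e : 'M[R]_#|T| :=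
  \matrix_(i, j) (e (enum_val i) (enum_val j))%:R.

Definition value (R : realType) (nu : nat) (f : 'M[R]_(#|T|, nu)) x : 'rV[R]_nu :=
  row (enum_rank x) f.

Definition perfect_structure (R : realType) (nu : nat) e
    (S : 'M[R]_nu) (f : 'M[R]_(#|T|, nu)) : Prop :=
  adjacency_matrix R e *m f = f *m S.

End Graph.

Definition word (q n : nat) : finType := n.-tuple 'I_q.

Definition cube_adj (q n : nat) : rel (word q n) :=
  fun u v => #|[set i : 'I_n | tnth u i != tnth v i]|%SET == 1%N.

Section WeightEnumerator.
Context {R : realType} {q n nu : nat}.
Implicit Types (f : 'M[R]_(#|word q n|, nu)) (x : word q n) (z : R).

Definition weight_distribution f x : 'M[R]_(n.+1, nu) :=
  \matrix_(w < n.+1) \sum_(v | at_distance (@cube_adj q n) w x v) value f v.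

Definition weight_enumerator f x z : 'rV[R]_nu :=
  \sum_(w < n.+1) z ^+ w *: row w (weight_distribution f x).

End WeightEnumerator.

(* The limit is for the (entrywise) topology of 'M[R]_m. *)
Definition expmx (R : realType) (m : nat) (M : 'M[R]_m) : 'M[R]_m :=
  limn (series (fun k : nat => (k`!%:R : R)^-1 *: M ^+ k)).

(* t^M, meaningful for 0 < t only *)
Definition powRmx (R : realType) (m : nat) (t : R) (M : 'M[R]_m) : 'M[R]_m :=
  expmx (ln t *: M).

Definition Zmx (R : realType) (nu : nat) (S : 'M[R]_nu) (n q : nat) (z : R) :
    'M[R]_nu :=
  powRmx (1 - z) (q%:R^-1 *: (((q%:R - 1) * n%:R)%:M - S))
  *m powRmx (1 + (q%:R - 1) * z) (q%:R^-1 *: (n%:R%:M + S)).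

(* Main.v *)
Require Import Defs.
From HB Require Import structures.
From mathcomp Require Import all_boot all_order all_algebra.
From mathcomp Require Import ring.
From mathcomp Require Import all_classical all_reals all_analysis.
Import Order.TTheory GRing.Theory Num.Theory.
Import numFieldNormedType.Exports.
Local Open Scope classical_set_scope.
Local Open Scope ring_scope.

(** The distance of two words is a sum over coordinates, so the matrix
    (z ^ d(u, v))_{u,v} is the n-fold tensor power of the q x q matrix with 1 on
    the diagonal and z elsewhere.  With E the matrix all of whose entries are
    1/q, that small matrix is (1 + (q-1)z) E + (1 - z) (1 - E), where E and
    1 - E are complementary projections.  Tensoring, each set T of coordinates
    gives the projection P_T equal to E on the coordinates in T and to 1 - E on
    the others ([eigen_kernel]); these sum to the identity
    ([sum_eigen_kernel]), and (z ^ d(u, v)) acts on the image of P_T as the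
    scalar (1 + (q-1)z)^|T| (1-z)^(n-|T|).  This is proved with z a polynomial
    variable ([eigen_kernel_mul]), so that it yields two facts: evaluation at a
    real z gives the weight enumerator ([weight_enumerator_eigen_part]), while
    the coefficient of z^1 says that the adjacency matrix A acts on the image of
    P_T as q|T| - n ([eigen_kernel_adjacent]).

    Hence the value of f at x is the sum over T of the rows y_T of P_T f at x,
    and since P_T f S = P_T A f = (q|T| - n) P_T f, each y_T is a left
    eigenvector of S ([eigen_part_mul]).  The two exponents of Z then act on y_T
    as the natural numbers n - |T| and |T|, so that the two matrix powers act on
    y_T as (1-z)^(n-|T|) and (1+(q-1)z)^|T|: exactly the factor with which y_T
    enters the weight enumerator.

    The only analysis involved is that the exponential series of a matrix
    converges ([is_cvg_expmx]), and that its limit acts on an eigenvector by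
    the exponential of the eigenvalue ([mulmx_expmx_eigen]). *)

(** * The matrix exponential *)

Lemma is_cvg_mx (R : realType) (m p : nat) (u : nat -> 'M[R]_(m, p)) :
  (forall i j, cvgn (fun k => u k i j)) -> cvgn u.
Proof.
move=> cu; apply/cvg_ex; exists (\matrix_(i, j) limn (fun k => u k i j)).
apply/cvg_mx_entourageP => A entA.
have H (ij : 'I_m * 'I_p) :
    \forall k \near \oo, (limn (fun k => u k ij.1 ij.2), u k ij.1 ij.2) \in A.
  have /cvg_app_entourageP/(_ A entA) := cu ij.1 ij.2.
  by apply: filterS => k /=; rewrite inE.
have {}H : \forall k \near \oo, forall ij : 'I_m * 'I_p,
    (limn (fun k => u k ij.1 ij.2), u k ij.1 ij.2) \in A.
  exact: filter_forall.
suff : \forall k \near \oo, forall i j,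
    ((\matrix_(i, j) limn (fun k => u k i j)) i j, u k i j) \in A by [].
by apply: filterS H => k Hk i j; rewrite mxE; exact: (Hk (i, j)).
Qed.

Lemma norm_mx_exp_le (R : realType) (m : nat) (M : 'M[R]_m) (k : nat) i j :
  `|(M ^+ k) i j| <= (\sum_i \sum_j `|M i j|) ^+ k.
Proof.
set c := \sum_i _.
have c0 : 0 <= c by apply: sumr_ge0 => a _; apply: sumr_ge0 => b _.
elim: k i j => [|k IHk] i j.
  by rewrite !expr0 mxE; case: eqP => _; rewrite ?normr1 ?normr0.
rewrite exprS mxE (le_trans (ler_norm_sum _ _ _))//.
apply: (@le_trans _ _ (\sum_l `|M i l| * c ^+ k)).
  by apply: ler_sum => l _; rewrite normrM ler_wpM2l.
rewrite -mulr_suml exprS ler_wpM2r ?exprn_ge0// /c [leRHS](bigD1 i)//= lerDl.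
by apply: sumr_ge0 => a _; apply: sumr_ge0 => b _.
Qed.

(** Each entry is dominated by the scalar exponential series at the sum of the
    absolute values of the entries of M. *)
Lemma is_cvg_expmx (R : realType) (m : nat) (M : 'M[R]_m) :
  cvgn (series (fun k : nat => (k`!%:R : R)^-1 *: M ^+ k)).
Proof.
apply: is_cvg_mx => i j.
rewrite (_ : (fun k => _) = series (fun k => (k`!%:R : R)^-1 * (M ^+ k) i j)).
  apply: normed_cvg.
  apply: series_le_cvg (is_cvg_series_exp_coeff (\sum_i \sum_j `|M i j|)).
  - by move=> k; exact: normr_ge0.
  - move=> k; apply: exp_coeff_ge0.
    by apply: sumr_ge0 => a _; apply: sumr_ge0 => b _.
  - move=> k; rewrite /exp_coeff/= normrM mulrC (@ger0_norm _ _^-1) ?invr_ge0//.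
    by rewrite ler_wpM2r ?invr_ge0// norm_mx_exp_le.
apply/funext => k; rewrite /series/= summxE.
by apply: eq_bigr => l _; rewrite mxE.
Qed.

(** On y the partial sums are those of the scalar series; the limits are
    compared one coordinate at a time, where they are limits in R. *)
Lemma mulmx_expmx_eigen (R : realType) (m : nat) (M : 'M[R]_m) (y : 'rV[R]_m)
    (a : R) :
  y *m M = a *: y -> y *m expmx M = expR a *: y.
Proof.
move=> yM; apply/rowP => j; rewrite !mxE.
have yMk k : y *m M ^+ k = a ^+ k *: y.
  elim: k => [|k IHk]; first by rewrite !expr0 mulmx1 scale1r.
  by rewrite exprSr mulmxA IHk -scalemxAl yM scalerA -exprSr.
set u := fun k : nat => (k`!%:R : R)^-1 *: M ^+ k.
have cu : series u @ \oo --> expmx M by exact: is_cvg_expmx.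
have cv1 : (\sum_l y 0 l * (series u k) l j)%R @[k --> \oo]
     --> (\sum_l y 0 l * (expmx M) l j)%R.
  apply: cvg_big => [|l _]; first exact: add_continuous.
  apply: cvgM; first exact: cvg_cst.
  have cuE := cvg_comp (series u) (fun A : 'M[R]_m => A l j) cu.
  by apply: cuE; exact: coord_continuous.
have cv2 : (series (exp_coeff a) k * y 0 j) @[k --> \oo] --> expR a * y 0 j.
  by apply: cvgM; [exact: is_cvg_series_exp_coeff | exact: cvg_cst].
suff E : (fun k => \sum_l y 0 l * (series u k) l j) =
    (fun k => series (exp_coeff a) k * y 0 j).
  by rewrite E in cv1; exact: cvg_unique cv1 cv2.
apply/funext => k.
transitivity ((y *m series u k) 0 j); first by rewrite mxE.
rewrite /series/= mulmx_sumr summxE mulr_suml; apply: eq_bigr => l _.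
by rewrite /u -scalemxAr yMk !mxE /exp_coeff/= mulrCA mulrA.
Qed.

(** Only natural eigenvalues occur below, and for them the real power of t is
    an ordinary power. *)
Lemma mulmx_powRmx_eigen (R : realType) (m : nat) (t : R) (M : 'M[R]_m)
    (y : 'rV[R]_m) (k : nat) :
  0 < t -> y *m M = k%:R *: y -> y *m powRmx t M = t ^+ k *: y.
Proof.
move=> t0 yM; rewrite /powRmx (@mulmx_expmx_eigen _ _ _ _ (k%:R * ln t)).
  by rewrite expRM_natl lnK.
by rewrite -scalemxAr yM scalerA mulrC.
Qed.

(** * The Hamming distance is the graph distance of the cube *)

Section Hamming.
Context {q n : nat}.
Implicit Types u v w : word q n.

Definition hamming u v : nat := #|[set i : 'I_n | tnth u i != tnth v i]|%SET.

Lemma hamming_le u v : (hamming u v <= n)%N.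
Proof. by rewrite -[leqRHS]card_ord max_card. Qed.

Lemma hamming_triangle u v w : (hamming u w <= hamming u v + hamming v w)%N.
Proof.
apply: leq_trans (leq_card_setU _ _); apply: subset_leq_card.
apply/fintype.subsetP => i; rewrite !inE -negb_and; apply: contra.
by case/andP => /eqP-> /eqP->.
Qed.

Lemma hamming_le_path u (p : seq (word q n)) :
  path (@cube_adj q n) u p -> (hamming u (last u p) <= size p)%N.
Proof.
elim: p u => [|v p IHp] u /=.
  by move=> _; rewrite leqn0 cards_eq0; apply/eqP/setP => i; rewrite !inE eqxx.
case/andP=> /eqP uv /IHp vp; apply: leq_trans (hamming_triangle _ v _) _.
by rewrite /hamming uv add1n ltnS.
Qed.

Lemma hamming_eq0 u v : (hamming u v == 0)%N = (u == v).
Proof.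
rewrite cards_eq0; apply/eqP/eqP => [E|->].
  apply: eq_from_tnth => i; apply/eqP.
  by have /finset.setP/(_ i) := E; rewrite !inE => /negbFE.
by apply/setP => i; rewrite !inE eqxx.
Qed.

(** Correct the positions where u and v differ one at a time. *)
Lemma hamming_path k u v : hamming u v = k ->
  exists2 p : k.-tuple (word q n), path (@cube_adj q n) u p & last u p = v.
Proof.
elim: k u => [|k IHk] u.
  by move=> /eqP; rewrite hamming_eq0 => /eqP ->; exists [tuple].
move=> uv.
have /card_gt0P[i] : (0 < hamming u v)%N by rewrite uv.
rewrite inE => uvi.
pose w : word q n := [tuple if j == i then tnth v j else tnth u j | j < n].
have uw : [set j | tnth u j != tnth w j]%SET = [set i]%SET.
  apply/setP => j; rewrite !inE tnth_mktuple.
  by case: (eqVneq j i) => [->//|_]; rewrite eqxx.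
have wv : [set j | tnth w j != tnth v j]%SET
    = ([set j | tnth u j != tnth v j] :\ i)%SET.
  apply/setP => j; rewrite !inE tnth_mktuple.
  by case: (eqVneq j i) => //= _; rewrite eqxx.
have [|p pw pv] := IHk w.
  by move: uv; rewrite /hamming wv (cardsD1 i) inE uvi add1n => -[].
exists [tuple of w :: p] => //=.
by rewrite pw andbT /cube_adj uw cards1.
Qed.

Lemma at_distanceE k u v :
  at_distance (@cube_adj q n) k u v = (hamming u v == k).
Proof.
have walk_le j : walk (@cube_adj q n) j u v -> (hamming u v <= j)%N.
  case/existsP => p /andP[pu /eqP <-]; rewrite -[leqRHS](size_tuple p).
  exact: hamming_le_path.
have walk_h : walk (@cube_adj q n) (hamming u v) u v.
  have [p pu pv] := @hamming_path _ u v erefl.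
  by apply/existsP; exists p; rewrite pu pv eqxx.
apply/andP/eqP => [[/walk_le hk /forallP short]|<-].
  apply/eqP; rewrite eqn_leq hk leqNgt; apply/negP => kh.
  by have := short (Ordinal kh); rewrite walk_h.
split=> //; apply/forallP => j; apply/negP => /walk_le.
by rewrite leqNgt ltn_ord.
Qed.

(** * Sums of products over the coordinates *)

Lemma expr_hamming (K : comNzRingType) (z : K) u v :
  z ^+ hamming u v = \prod_i (if tnth u i == tnth v i then 1 else z).
Proof.
rewrite (bigID (fun i => tnth u i == tnth v i))/= big1 => [|i ->//].
rewrite mul1r (eq_bigr (fun=> z)) => [|i /negPf ->//].
by rewrite prodr_const /hamming cardsE.
Qed.

Lemma sum_word_prod (K : comNzRingType) (F : 'I_n -> 'I_q -> K) :
  \sum_(w : word q n) \prod_i F i (tnth w i) = \prod_i \sum_a F i a.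
Proof.
rewrite bigA_distr_bigA/=.
rewrite (reindex (fun g : {ffun 'I_n -> 'I_q} => [tuple g i | i < n]))/=.
  by apply: eq_bigr => g _; apply: eq_bigr => i _; rewrite tnth_mktuple.
exists (fun w : word q n => [ffun i => tnth w i]) => [g _|w _].
  by apply/ffunP => i; rewrite ffunE tnth_mktuple.
by apply: eq_from_tnth => i; rewrite tnth_mktuple ffunE.
Qed.

End Hamming.

(** * Common eigenvectors of the distance matrices *)

Section EigenKernel.
Context (R : realType) (q n : nat).
Hypothesis q_gt0 : (0 < q)%N.
Implicit Types (u v x : word q n) (T : {set 'I_n}).

Let qF : q%:R != 0 :> R.
Proof. by rewrite pnatr_eq0 -lt0n. Qed.

Let card_le_n T : (#|T| <= n)%N.
Proof. by rewrite -[leqRHS]card_ord max_card. Qed.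

(** The entry at (u, v) of the orthogonal projection, in the tensor power
    (R^q)^(tensor n), onto the functions that are constant in each coordinate
    of T and have mean zero in each other coordinate. *)
Definition eigen_kernel T u v : R :=
  \prod_i (if i \in T then q%:R^-1
           else (tnth u i == tnth v i)%:R - q%:R^-1).

(** Expand, over the choices of T, the product over the coordinates of
    1 = E + (1 - E). *)
Lemma sum_eigen_kernel u v : \sum_T eigen_kernel T u v = (u == v)%:R.
Proof.
transitivity (\prod_i ((q%:R^-1 : R)
    + ((tnth u i == tnth v i)%:R - q%:R^-1))).
  by rewrite bigA_distr; apply: eq_bigr.
rewrite (eq_bigr (fun i => (tnth u i == tnth v i)%:R : R)); last first.
  by move=> i _; ring.
case: eqVneq => [->|].
  by rewrite big1// => i _; rewrite eqxx.
rewrite -hamming_eq0 -lt0n => /card_gt0P[i]; rewrite inE => /negPf uvi.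
by rewrite (bigD1 i)//= uvi mul0r.
Qed.

Lemma sum_if_eq_ord (K : comNzRingType) (z : K) (c : 'I_q) :
  \sum_(a < q) (if a == c then 1 else z) = 1 + (q%:R - 1) * z.
Proof.
rewrite (bigD1 c)//= eqxx (eq_bigr (fun=> z)) => [|a /negPf ->//].
rewrite sumr_const cardC1 card_ord -[z *+ _]mulr_natl.
by rewrite -subn1 natrB.
Qed.

(** Both sides factor over the coordinates, so the identity reduces to
    E B = (1 + (q-1)X) E and (1 - E) B = (1 - X) (1 - E) for the q x q matrix B
    with 1 on the diagonal and X elsewhere. *)
Lemma eigen_kernel_mul T u v :
  \sum_w (eigen_kernel T u w)%:P * 'X^(hamming w v) =
  (1 + (q%:R - 1) * 'X) ^+ #|T| * (1 - 'X) ^+ (n - #|T|)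
    * (eigen_kernel T u v)%:P :> {poly R}.
Proof.
pose g i (a c : 'I_q) : R :=
  if i \in T then q%:R^-1 else (a == c)%:R - q%:R^-1.
have gE w w' : eigen_kernel T w w' = \prod_i g i (tnth w i) (tnth w' i) by [].
have muE : \prod_i (if i \in T then 1 + (q%:R - 1) * 'X else 1 - 'X)
    = (1 + (q%:R - 1) * 'X) ^+ #|T| * (1 - 'X) ^+ (n - #|T|) :> {poly R}.
  rewrite (bigID (fun i => i \in T))/=; congr (_ * _).
    rewrite (eq_bigr (fun=> 1 + (q%:R - 1) * 'X)) => [|i ->//].
    by rewrite prodr_const.
  rewrite (eq_bigr (fun=> 1 - 'X)) => [|i /negPf ->//].
  rewrite prodr_const; congr (_ ^+ _).
  by apply/eqP; rewrite -(eqn_add2l #|T|) cardC card_ord subnKC// card_le_n.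
rewrite -muE gE rmorph_prod -big_split/=.
under eq_bigr do rewrite gE rmorph_prod expr_hamming -big_split/=.
rewrite (sum_word_prod _ (fun i a => (g i (tnth u i) a)%:P
  * (if a == tnth v i then 1 else 'X))).
apply: eq_bigr => i _; move: (tnth u i) (tnth v i) => a c.
rewrite /g; case: ifP => _; first by rewrite -mulr_sumr sum_if_eq_ord mulrC.
under eq_bigr do rewrite polyCB mulrBl.
rewrite sumrB -mulr_sumr sum_if_eq_ord (bigD1 a)//= eqxx mul1r.
rewrite big1 => [|b]; last by rewrite eq_sym => /negPf ->; rewrite mul0r.
have qK : q%:R * (q%:R^-1)%:P = 1 :> {poly R}.
  by rewrite -polyC_natr -polyCM divff.
rewrite polyCB; set r := (q%:R^-1)%:P in qK *; rewrite addr0.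
case: eqVneq => _; rewrite ?polyC1 ?polyC0.
  transitivity (1 - r * (1 - 'X) - (q%:R * r) * 'X); first by ring.
  by rewrite qK; ring.
transitivity ('X - r * (1 - 'X) - (q%:R * r) * 'X); first by ring.
by rewrite qK; ring.
Qed.

Lemma eigen_kernel_expr T u v (z : R) :
  \sum_w eigen_kernel T u w * z ^+ hamming w v =
  (1 + (q%:R - 1) * z) ^+ #|T| * (1 - z) ^+ (n - #|T|) * eigen_kernel T u v.
Proof.
have := congr1 (horner^~ z) (eigen_kernel_mul T u v).
rewrite !(hornerE, horner_exp, horner_sum) -polyC_natr hornerC => <-.
by apply: eq_bigr => w _; rewrite !(hornerE, horner_exp).
Qed.

(** This is the coefficient of X in [eigen_kernel_mul]; the eigenvalue is
    (q-1)|T| - (n-|T|). *)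
Lemma eigen_kernel_adjacent T u v :
  \sum_w eigen_kernel T u w * (hamming w v == 1)%:R =
  (q%:R * #|T|%:R - n%:R) * eigen_kernel T u v.
Proof.
have coef1 (p : {poly R}) : p`_1 = (deriv p).[0].
  by rewrite horner_coef0 coef_deriv mulr1n.
have := congr1 (fun p : {poly R} => p`_1) (eigen_kernel_mul T u v).
rewrite coef_sum; under eq_bigr do rewrite coefCM coefXn eq_sym.
move=> ->; rewrite coefMC coef1; congr (_ * _).
rewrite derivM !deriv_exp !poly.derivE mul0rn subr0 mul0r add0r sub0r.
rewrite !(hornerE, hornerMn, horner_exp) !(subr0, expr1n, mulr1, mul1r).
rewrite -[X in X + _]mulr_natr -[X in _ + X]mulr_natr natrB.
  by ring.
exact: card_le_n.
Qed.

End EigenKernel.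

(** * Decomposition of a perfect structure *)

Section PerfectStructure.
Context (R : realType) (q n nu : nat).
Hypothesis q_gt0 : (0 < q)%N.
Context (S : 'M[R]_nu) (f : 'M[R]_(#|word q n|, nu)).
Implicit Types (x v w : word q n) (T : {set 'I_n}).

Definition eigen_part T x : 'rV[R]_nu :=
  \sum_v eigen_kernel R q n T x v *: value f v.

Lemma sum_eigen_part x : \sum_T eigen_part T x = value f x.
Proof.
rewrite exchange_big/=; under eq_bigr do rewrite -scaler_suml sum_eigen_kernel.
rewrite (bigD1 x)//= eqxx scale1r big1 ?addr0// => v.
by rewrite eq_sym => /negPf ->; rewrite scale0r.
Qed.

Lemma value_perfect_structure v : perfect_structure (@cube_adj q n) S f ->
  value f v *m S = \sum_w (hamming v w == 1)%:R *: value f w.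
Proof.
move=> hf; rewrite /value -row_mul -hf row_mul mulmx_sum_row.
rewrite (reindex_onto enum_rank enum_val) => [|i _]; last exact: enum_valK.
apply: eq_big => [w|w _]; first by rewrite enum_rankK eqxx.
by rewrite !mxE !enum_rankK.
Qed.

(** Multiplication of f by S on the right is multiplication by A on the left,
    which P_T turns into the scalar q|T| - n. *)
Lemma eigen_part_mul T x : perfect_structure (@cube_adj q n) S f ->
  eigen_part T x *m S = (q%:R * #|T|%:R - n%:R) *: eigen_part T x.
Proof.
move=> hf; rewrite mulmx_suml scaler_sumr.
under eq_bigr do rewrite -scalemxAl value_perfect_structure// scaler_sumr.
rewrite exchange_big/=; apply: eq_bigr => w _.
rewrite scalerA -eigen_kernel_adjacent// scaler_suml.
by apply: eq_bigr => v _; rewrite scalerA.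
Qed.

Lemma weight_enumerator_hamming x z :
  weight_enumerator f x z = \sum_v z ^+ hamming x v *: value f v.
Proof.
rewrite /weight_enumerator.
rewrite (partition_big (fun v => inord (hamming x v) : 'I_n.+1) predT)//=.
apply: eq_bigr => w _; rewrite rowK scaler_sumr.
apply: eq_big => [v|v]; last by rewrite at_distanceE => /eqP ->.
rewrite at_distanceE -(inj_eq val_inj)/= inordK// ltnS; exact: hamming_le.
Qed.

(** Insert the identity, as the sum of the P_T, in front of the matrix
    (z ^ d(u, v)). *)
Lemma weight_enumerator_eigen_part x z :
  weight_enumerator f x z =
  \sum_(T : {set 'I_n}) ((1 + (q%:R - 1) * z) ^+ #|T| * (1 - z) ^+ (n - #|T|))
    *: eigen_part T x.
Proof.
rewrite weight_enumerator_hamming.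
under [RHS]eq_bigr do rewrite scaler_sumr.
rewrite exchange_big/=; apply: eq_bigr => v _.
under [RHS]eq_bigr do rewrite scalerA -eigen_kernel_expr//.
rewrite -scaler_suml exchange_big/=; congr (_ *: _).
under [RHS]eq_bigr do rewrite -mulr_suml sum_eigen_kernel.
rewrite (bigD1 x)//= eqxx mul1r big1 ?addr0// => w.
by rewrite eq_sym => /negPf ->; rewrite mul0r.
Qed.

End PerfectStructure.

Theorem theorem4 (R : realType) (q n nu : nat) (hq : (2 <= q)%N)
    (S : 'M[R]_nu) (f : 'M[R]_(#|word q n|, nu))
    (hf : perfect_structure (@cube_adj q n) S f)
    (x : word q n) (z : R) (hz1 : 0 < 1 - z) (hz2 : 0 < 1 + (q%:R - 1) * z) :
  weight_enumerator f x z = value f x *m Zmx S n q z.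
Proof.
have q_gt0 : (0 < q)%N by exact: ltnW.
have qF : q%:R != 0 :> R by rewrite pnatr_eq0 -lt0n.
rewrite weight_enumerator_eigen_part// -(sum_eigen_part _ _ _ _ f x) mulmx_suml.
apply: eq_bigr => T _; set y := eigen_part _ _ _ _ _ _ _.
have yS : y *m S = (q%:R * #|T|%:R - n%:R) *: y by exact: eigen_part_mul.
have Tn : (#|T| <= n)%N by rewrite -[leqRHS]card_ord max_card.
have y1 : y *m (q%:R^-1 *: (((q%:R - 1) * n%:R)%:M - S))
    = (n - #|T|)%:R *: y.
  rewrite -scalemxAr mulmxBr mul_mx_scalar yS -scalerBl scalerA natrB//.
  by congr (_ *: _); field.
have y2 : y *m (q%:R^-1 *: (n%:R%:M + S)) = #|T|%:R *: y.
  rewrite -scalemxAr mulmxDr mul_mx_scalar yS -scalerDl scalerA.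
  by congr (_ *: _); field.
rewrite mulmxA (mulmx_powRmx_eigen _ _ _ _ _ _ hz1 y1).
by rewrite -scalemxAl (mulmx_powRmx_eigen _ _ _ _ _ _ hz2 y2) scalerA mulrC.
Qed.
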